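(* Let $n\ge 1$, $f\in[0,1]^n\setminus\mathbb{Z}^n$, and let $R,Q\subseteq\mathbb{R}^n$ be arbitrary (not necessarily finite) sets. Consider the generalized corner relaxation $\mathcal{C}(f,R,Q)$. Then the $\alpha$-cuts are exactly the split cuts for $\mathcal{C}(f,R,Q)$, in the following sense: (i) for every $\alpha\in\mathbb{Z}_f$, the $\alpha$-cut $(\psi^f_\alpha|_R,\pi^f_\alpha|_Q)$ is a split cut for $\mathcal{C}(f,R,Q)$; (ii) for every split cut $(\psi,\pi)$ for $\mathcal{C}(f,R,Q)$ there is $\alpha\in\mathbb{Z}_f$ such that $(\psi,\pi)$ is dominated by $(\psi^f_\alpha|_R,\pi^f_\alpha|_Q)$ with respect to $\mathcal{C}_{LP}(f,R,Q)$.
   Context: For a set $T$, $\mathbb{R}^{(T)}_+$ denotes the set of functions $T\to\mathbb{R}_+=[0,\infty)$ with finite support. $\mathcal{C}_{LP}(f,R,Q)$ is the set of all $(x,s,y)$ with $x\in\mathbb{R}^n$, $s\in\mathbb{R}^{(R)}_+$, $y\in\mathbb{R}^{(Q)}_+$ and $x=f+\sum_{r\in R} r\,s(r)+\sum_{q\in Q} q\,y(q)$. The generalized corner relaxation $\mathcal{C}(f,R,Q)$ is the set of $(x,s,y)\in\mathcal{C}_{LP}(f,R,Q)$ with $x\in\mathbb{Z}^n$ and $y(q)\in\mathbb{Z}$ for all $q\in Q$. A cut is a pair $(\psi,\pi)$ of non-negative functions $\psi:R\to\mathbb{R}_+$, $\pi:Q\to\mathbb{R}_+$; a point $(x,s,y)$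 satisfies it if $\sum_{r\in R}\psi(r)s(r)+\sum_{q\in Q}\pi(q)y(q)\ge 1$. The cut is valid for a set of points if all of them satisfy it. For a set $X$ of points, $(\psi,\pi)$ dominates $(\psi',\pi')$ with respect to $X$ (equivalently, $(\psi',\pi')$ is dominated by $(\psi,\pi)$) if every point of $X$ satisfying $(\psi,\pi)$ also satisfies $(\psi',\pi')$. For vectors $\alpha,v\in\mathbb{R}^n$, $\alpha v$ denotes their inner product. $\mathbb{Z}_f=\{w\in\mathbb{Z}^n: wf\notin\mathbb{Z}\}$. Split cuts: for $\alpha\in\mathbb{Z}_f$ and $\beta:Q\to\mathbb{Z}$, let $$D(\alpha,\beta,f)=\Big\{(x,s,y):\alpha x+\sum_{q\in Q}\beta(q)y(q)\le\lfloor\alpha f\rfloor\Big\}\cup\Big\{(x,s,y):\alpha x+\sum_{q\in Q}\beta(q)y(q)\ge\lceil\alpha f\rceil\Big\}.$$ A cut $(\psi,\pi)$ is a split cut for $\mathcal{C}(f,R,Q)$ if for some $\alpha\in\mathbb{Z}_f$ and $\beta:Q\to\mathbb{Z}$ it is satisfied by all points of $\mathcal{C}_{LP}(f,R,Q)\cap D(\alpha,\beta,f)$. $\alpha$-cuts: for $a\in\mathbb{R}$ let $[a]=a-\lfloor a\rfloor$. For $g\in\mathbb{R}\setminus\mathbb{Z}$ and $r,q\in\mathbb{R}$ define the GMI function $\psi^g_{GMI}(r)=\max\{\frac{r}{1-[g]},-\frac{r}{[g]}\}$ and $\pi^g_{GMI}(q)=\min\{\frac{[q]}{1-[g]},\frac{1-[q]}{[g]}\}$.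 For $\alpha\in\mathbb{Z}_f$ the $\alpha$-cut function is given by $\psi^f_\alpha(r)=\psi^{\alpha f}_{GMI}(\alpha r)$ and $\pi^f_\alpha(q)=\pi^{\alpha f}_{GMI}(\alpha q)$ for $r,q\in\mathbb{R}^n$. *)

(* Defs.v *)
From HB Require Import structures.
From mathcomp Require Import all_boot all_order all_algebra.
From mathcomp Require Import mathcomp_extra boolp classical_sets functions.
From mathcomp Require Import cardinality fsbigop reals.

Set Implicit Arguments.
Unset Strict Implicit.
Unset Printing Implicit Defensive.

Import Order.TTheory GRing.Theory Num.Theory.
Local Open Scope classical_set_scope.
Local Open Scope ring_scope.

Section Cuts.
Context {K : realType} {n : nat}.
Implicit Types (f a v w : 'rV[K]_n) (R Q : set 'rV[K]_n).

Definition inner a v : K := \sum_(i < n) a ord0 i * v ord0 i.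

(* The integral vectors w whose inner product with f is not an integer. *)
Definition Zf f : set 'rV[K]_n :=
  [set w | w \is a mxOver Num.int /\ inner w f \isn't a Num.int].

(* Functions T -> [0, +oo[ with finite support. *)
Definition finsupp_nneg (T : Type) (s : T -> K) : Prop :=
  (forall t, 0 <= s t) /\ finite_set [set t | s t != 0].

(* A set R used as a type is the subtype {r | r \in R}.  Nonnegativity and
   finiteness of the support of s and y are imposed by membership in C_LP. *)
Record point R Q := Point { px : 'rV[K]_n; ps : R -> K; py : Q -> K }.

(* The sums \sum_(t \in [set: T]) F t below range over the support of F, and
   are 0 by convention when that support is infinite; this convention is never
   used at points of C_LP. *)
Definition C_LP f R Q : set (point R Q) :=
  [set p | [/\ finsupp_nneg (ps p), finsupp_nneg (py p) &
    px p = f + \sum_(r \in [set: R]) (ps p r *: val r)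
             + \sum_(q \in [set: Q]) (py p q *: val q)]].

Definition is_cut R Q (psi : R -> K) (pi : Q -> K) : Prop :=
  (forall r, 0 <= psi r) /\ (forall q, 0 <= pi q).

Definition satisfies R Q (psi : R -> K) (pi : Q -> K) (p : point R Q) : Prop :=
  1 <= \sum_(r \in [set: R]) (psi r * ps p r)
     + \sum_(q \in [set: Q]) (pi q * py p q).

Definition valid R Q (X : set (point R Q)) (psi : R -> K) (pi : Q -> K) : Prop :=
  forall p, X p -> satisfies psi pi p.

Definition dominates R Q (X : set (point R Q))
    (psi : R -> K) (pi : Q -> K) (psi' : R -> K) (pi' : Q -> K) : Prop :=
  forall p, X p -> satisfies psi pi p -> satisfies psi' pi' p.

Definition split_lhs R Q a (beta : Q -> int) (p : point R Q) : K :=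
  inner a (px p) + \sum_(q \in [set: Q]) ((beta q)%:~R * py p q).

Definition split_disj f R Q a (beta : Q -> int) : set (point R Q) :=
  [set p | split_lhs a beta p <= (Num.floor (inner a f))%:~R] `|`
  [set p | (Num.ceil (inner a f))%:~R <= split_lhs a beta p].

(* Split cuts for the corner relaxation C(f, R, Q), the set of points of C_LP
   with x and all y(q) integral: their definition only involves C_LP. *)
Definition is_split_cut f R Q (psi : R -> K) (pi : Q -> K) : Prop :=
  is_cut psi pi /\
  exists a (beta : Q -> int), Zf f a /\
    valid (@C_LP f R Q `&` split_disj f a beta) psi pi.

Definition frac (x : K) : K := x - (Num.floor x)%:~R.

Definition psi_GMI (g r : K) : K :=
  Num.max (r / (1 - frac g)) (- (r / frac g)).

Definition pi_GMI (g q : K) : K :=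
  Num.min (frac q / (1 - frac g)) ((1 - frac q) / frac g).

Definition psi_alpha f a v : K := psi_GMI (inner a f) (inner a v).
Definition pi_alpha f a v : K := pi_GMI (inner a f) (inner a v).

End Cuts.

Arguments C_LP {K n} f R Q _.

(* Main.v *)
Require Import Defs.
From mathcomp Require Import all_boot all_order all_algebra.
From mathcomp Require Import boolp classical_sets cardinality fsbigop reals.
From mathcomp Require Import finmap ring lra.

Set Implicit Arguments.
Unset Strict Implicit.
Unset Printing Implicit Defensive.

Import Order.TTheory GRing.Theory Num.Theory.
Local Open Scope classical_set_scope.
Local Open Scope ring_scope.

(** Write [g = inner alpha f] and [F] for its fractional part, so [0 < F < 1].
    Both inclusions come from comparing coefficients with [psi_GMI g], the
    gauge of the interval [[-F, 1 - F]]: along the real line, [psi_GMI g u] is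
    the inverse of the time needed to go from [g] to the next or the previous
    integer at speed [u].

    The link with integer variables is that
    [pi_GMI g v = min_b psi_GMI g (v + b)] over the integers [b]
    ([pi_GMI_attained], [pi_GMI_le_shift]): the freedom of [beta] in a split is
    exactly the freedom to shift each [inner alpha q] by an integer, and the
    alpha-cut uses the best shift for every [q].

    (i) With [beta] the family of best shifts, the left-hand side of the
    alpha-cut at a point of [C_LP] is a nonnegative combination of values of
    [psi_GMI g]. As [psi_GMI g] dominates the two linear functions [u / (1 - F)]
    and [- u / F], this combination is at least their value at
    [split_lhs alpha beta p - g], and one of these two values is at least 1 on
    each side of the split ([alpha_cut_is_split_cut]).

    (ii) Let [(psi, pi)] be a split cut, for [alpha] and [beta]. Its validity at
    the points of [C_LP] where a single [s(r)] or [y(q)] is nonzero bounds each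
    coefficient from below by [psi_GMI g (inner alpha r)], respectively
    [psi_GMI g (inner alpha q + beta q)], hence by the coefficient of the
    alpha-cut ([split_cut_ge_alpha_cut]). Domination follows, as [s] and [y] are
    nonnegative. *)

(** * Fractional parts *)

Lemma frac_ge0 (K : realType) (g : K) : 0 <= Defs.frac g.
Proof. by rewrite subr_ge0 floor_le. Qed.

Lemma frac_lt1 (K : realType) (g : K) : Defs.frac g < 1.
Proof. by have := floorD1_gt g; rewrite /Defs.frac intrD; lra. Qed.

Lemma frac_gt0 (K : realType) (g : K) : g \isn't a Num.int -> 0 < Defs.frac g.
Proof.
move=> gNint; rewrite lt_def frac_ge0 andbT subr_eq0.
by apply: contra gNint => /eqP ->; apply: intr_int.
Qed.

Lemma floor_frac (K : realType) (g : K) : (Num.floor g)%:~R = g - Defs.frac g.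
Proof. by rewrite /Defs.frac; lra. Qed.

Lemma ceil_frac (K : realType) (g : K) :
  g \isn't a Num.int -> (Num.ceil g)%:~R = g + (1 - Defs.frac g).
Proof. by move=> gNint; rewrite ceil_floor gNint intrD floor_frac /=; lra. Qed.

(** * The GMI functions *)

Section GMI.
Context {K : realType} (g : K).
Hypothesis gNint : g \isn't a Num.int.

Let F_gt0 : 0 < Defs.frac g := frac_gt0 gNint.
Let F_lt1 : 0 < 1 - Defs.frac g.
Proof. by rewrite subr_gt0 frac_lt1. Qed.

Lemma psi_GMI_pos u : 0 <= u -> psi_GMI g u = (1 - Defs.frac g)^-1 * u.
Proof.
move=> u0; rewrite /psi_GMI mulrC; apply/max_idPl.
by apply: (@le_trans _ _ 0); rewrite ?oppr_le0 ?mulr_ge0 ?invr_ge0 // ltW.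
Qed.

Lemma psi_GMI_neg u : u <= 0 -> psi_GMI g u = - (Defs.frac g)^-1 * u.
Proof.
move=> u0; rewrite /psi_GMI mulNr [_^-1 * u]mulrC; apply/max_idPr.
apply: (@le_trans _ _ 0).
  by rewrite mulr_le0_ge0 // invr_ge0 ltW.
by rewrite oppr_ge0 mulr_le0_ge0 // invr_ge0 ltW.
Qed.

Lemma psi_GMI_ge0 u : 0 <= psi_GMI g u.
Proof.
case: (leP 0 u) => [u0|/ltW u0].
  by rewrite psi_GMI_pos // mulr_ge0 // invr_ge0 ltW.
by rewrite psi_GMI_neg // mulNr -mulrN mulr_ge0 ?oppr_ge0 // invr_ge0 ltW.
Qed.

(** [psi_GMI] lies above each of the two linear functions of which it is the
    maximum; the first reaches 1 where [g + u] is the next integer, the second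
    where it is the previous one. *)
Lemma psi_GMI_ge_ceil u : (1 - Defs.frac g)^-1 * u <= psi_GMI g u.
Proof. by rewrite mulrC le_max lexx. Qed.

Lemma psi_GMI_ge_floor u : - (Defs.frac g)^-1 * u <= psi_GMI g u.
Proof. by rewrite mulNr [_^-1 * u]mulrC le_max lexx orbT. Qed.

(** The two pieces of the minimum defining the coefficient of an integer
    variable are the values of the convex function [psi_GMI] at the two
    representatives of [v] modulo 1 that lie closest to 0 on either side. *)
Lemma pi_GMI_attained v : exists b : int, pi_GMI g v = psi_GMI g (v + b%:~R).
Proof.
have up : psi_GMI g (v + (- Num.floor v)%:~R) = Defs.frac v / (1 - Defs.frac g).
  by rewrite intrN psi_GMI_pos ?frac_ge0 // mulrC.
have down : psi_GMI g (v + (- Num.floor v - 1)%:~R) = (1 - Defs.frac v) / Defs.frac g.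
  have := ltW (frac_lt1 v); rewrite intrB intrN /Defs.frac => v1.
  by rewrite psi_GMI_neg; [ring | lra].
rewrite /pi_GMI; case: leP => _; first by exists (- Num.floor v); rewrite up.
by exists (- Num.floor v - 1); rewrite down.
Qed.

(** A representative of [v] modulo 1 is either at least [frac v] or at most
    [frac v - 1], and [psi_GMI] grows away from 0 on both sides. *)
Lemma pi_GMI_le_shift v (b : int) : pi_GMI g v <= psi_GMI g (v + b%:~R).
Proof.
rewrite /pi_GMI ge_min; case: (leP (- Num.floor v) b) => vb.
  have : (- Num.floor v)%:~R <= b%:~R :> K by rewrite ler_int.
  rewrite intrN => vbK; apply/orP; left.
  apply: le_trans (psi_GMI_ge_ceil _).
  by rewrite mulrC ler_pM2l ?invr_gt0 // /Defs.frac; lra.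
have : (b + 1)%:~R <= (- Num.floor v)%:~R :> K by rewrite ler_int lezD1.
rewrite intrN intrD => vbK; apply/orP; right.
apply: le_trans (psi_GMI_ge_floor _).
by rewrite mulNr -mulrN mulrC ler_pM2l ?invr_gt0 // /Defs.frac; lra.
Qed.

(** Moving from [g] at speed [u], the first time at which the next or the
    previous integer is reached is the inverse of [psi_GMI g u]; hence a
    linear cut that is only required to hold outside of the open strip between
    these two integers has slope at least [psi_GMI g u]. *)
Lemma psi_GMI_le_slope u h : 0 <= h ->
  (forall t, 0 <= t ->
     g + u * t <= (Num.floor g)%:~R \/ (Num.ceil g)%:~R <= g + u * t ->
     1 <= h * t) ->
  psi_GMI g u <= h.
Proof.
rewrite (ceil_frac gNint) floor_frac => h0 cut.
case: (ltgtP u 0) => [u0|u0|->]; last by rewrite psi_GMI_pos // mulr0.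
(* The times at which the strip is left, downwards and then upwards. *)
- have/cut : 0 <= Defs.frac g / - u by rewrite divr_ge0 ?oppr_ge0 ?ltW.
  have -> : u * (Defs.frac g / - u) = - Defs.frac g by field; lra.
  move=> /(_ (or_introl (lexx _))).
  rewrite mulrA ler_pdivlMr ?oppr_gt0 // mul1r => uh.
  by rewrite psi_GMI_neg ?(ltW u0) // mulNr -mulrN [_^-1 * _]mulrC ler_pdivrMr.
- have/cut : 0 <= (1 - Defs.frac g) / u by rewrite divr_ge0 ?ltW.
  rewrite mulrC divfK ?gt_eqF // => /(_ (or_intror (lexx _))).
  rewrite mulrA ler_pdivlMr // mul1r => uh.
  by rewrite psi_GMI_pos ?(ltW u0) // [_^-1 * _]mulrC ler_pdivrMr.
Qed.

End GMI.

(** * Finitely supported sums *)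

Section FiniteSupport.
Context {K : realType} {T : choiceType}.
Implicit Types (s u h : T -> K).

(** The support of [s] serves as a common finite index set for all summands
    weighted by [s], so that sums with different supports can be compared and
    added termwise. *)
Lemma fsum_finsupp (V : nmodType) s (G : T -> V) :
  finsupp_nneg s -> (forall t, s t = 0 -> G t = 0) ->
  \sum_(t \in [set: T]) G t = \sum_(t <- fset_set [set t | s t != 0]) G t.
Proof.
move=> [_ sfin] G0; rewrite -fsbig_finite //; apply/esym/fsbig_widen => //.
by move=> t [_ /= /negP]; rewrite negbK => /eqP/G0.
Qed.

Lemma fsum_weight_le (c : K) u h s : finsupp_nneg s ->
  (forall t, c * u t <= h t) ->
  c * \sum_(t \in [set: T]) (u t * s t) <= \sum_(t \in [set: T]) (h t * s t).
Proof.
move=> sfs uh; rewrite !(fsum_finsupp sfs) => [|t ->|t ->]; rewrite ?mulr0//.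
rewrite mulr_sumr; apply: ler_sum => t _; rewrite mulrA.
by apply: ler_wpM2r => //; case: sfs.
Qed.

Lemma fsum_single (V : nmodType) t0 (G : T -> V) :
  (forall t, t != t0 -> G t = 0) -> \sum_(t \in [set: T]) G t = G t0.
Proof.
move=> G0; have <- : \sum_(t \in [set t0]) G t = G t0 by rewrite fsbig_set1.
apply/esym/fsbig_widen => //.
by move=> t [_ /= /eqP/G0].
Qed.

Lemma finsupp_nneg0 : finsupp_nneg (fun _ : T => 0 : K).
Proof.
split=> //; apply: (sub_finite_set _ (finite_set0 T)) => t /=.
by rewrite eqxx.
Qed.

Lemma finsupp_nneg_single t0 (c : K) : 0 <= c ->
  finsupp_nneg (fun t : T => if t == t0 then c else 0).
Proof.
move=> c0; split=> [t|]; first by case: ifP.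
apply: (sub_finite_set _ (finite_set1 t0)) => t /=.
by case: ifP => [/eqP //|_]; rewrite eqxx.
Qed.

End FiniteSupport.

(** * Split cuts and alpha-cuts *)

Section Cuts.
Context {K : realType} {n : nat}.
Implicit Types (f a v w : 'rV[K]_n) (R Q : set 'rV[K]_n).

Lemma innerDr a v w : inner a (v + w) = inner a v + inner a w.
Proof. by rewrite -big_split; apply: eq_bigr => i _; rewrite mxE mulrDr. Qed.

Lemma innerZr a (c : K) v : inner a (c *: v) = inner a v * c.
Proof.
by rewrite mulr_suml; apply: eq_bigr => i _; rewrite mxE mulrCA mulrC.
Qed.

Lemma inner0r a : inner a 0 = 0.
Proof. by rewrite -(scale0r 0) innerZr mulr0. Qed.

Lemma inner_fsum a R (s : R -> K) : finsupp_nneg s ->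
  inner a (\sum_(r \in [set: R]) (s r *: val r))
    = \sum_(r \in [set: R]) (inner a (val r) * s r).
Proof.
move=> sfs; rewrite !(fsum_finsupp sfs) => [|r ->|r ->];
  rewrite ?mulr0 ?scale0r //.
rewrite (big_morph (inner a) (innerDr a) (inner0r a)).
by apply: eq_bigr => r _; rewrite innerZr.
Qed.

(** On the linear relaxation the split functional becomes affine in
    [(s, y)] alone, and each integer variable enters with its own shift. *)
Lemma split_lhs_C_LP f R Q a (beta : Q -> int) (p : Defs.point R Q) : C_LP f R Q p ->
  split_lhs a beta p = inner a f
    + (\sum_(r \in [set: R]) (inner a (val r) * ps p r)
       + \sum_(q \in [set: Q]) ((inner a (val q) + (beta q)%:~R) * py p q)).
Proof.
case=> sfs yfs px_eq; rewrite /split_lhs px_eq !innerDr !inner_fsum //.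
rewrite -!addrA; congr (_ + (_ + _)).
rewrite !(fsum_finsupp yfs) => [|q ->|q ->|q ->]; rewrite ?mulr0 //.
by rewrite -big_split; apply: eq_bigr => q _; rewrite mulrDl.
Qed.

Definition point_of f R Q (s : R -> K) (y : Q -> K) : Defs.point R Q :=
  Point (f + \sum_(r \in [set: R]) (s r *: val r)
           + \sum_(q \in [set: Q]) (y q *: val q)) s y.

Lemma C_LP_point_of f R Q (s : R -> K) (y : Q -> K) :
  finsupp_nneg s -> finsupp_nneg y -> C_LP f R Q (point_of f s y).
Proof. by split. Qed.

(** Choose [beta] so that every integer variable gets the shift at which
    [psi_GMI] takes the value [pi_alpha]. The cut is then a nonnegative
    combination of values of [psi_GMI], which lies above both linear functions
    defining it; on either side of the split one of these two linear functions
    is at least 1. *)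
Lemma alpha_cut_is_split_cut f R Q a : Zf f a ->
  is_split_cut f (fun r : R => psi_alpha f a (val r))
                 (fun q : Q => pi_alpha f a (val q)).
Proof.
move=> Za; have [_ gNint] := Za; set g := inner a f in gNint *.
have F_gt0 := frac_gt0 gNint; have F_lt1 := frac_lt1 g.
have betaP (q : Q) := cid (pi_GMI_attained gNint (inner a (val q))).
pose beta q := projT1 (betaP q).
have betaE (q : Q) : pi_alpha f a (val q) = psi_GMI g (inner a (val q) + (beta q)%:~R).
  exact: projT2 (betaP q).
split.
  by split=> [r|q]; rewrite ?betaE psi_GMI_ge0.
exists a, beta; split=> // p [pC p_disj]; have [sfs yfs _] := pC.
have above (c : K) : (forall u, c * u <= psi_GMI g u) ->
    1 <= c * (split_lhs a beta p - g) ->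
    satisfies (fun r : R => psi_alpha f a (val r))
              (fun q : Q => pi_alpha f a (val q)) p.
  move=> c_le /le_trans; apply.
  rewrite (split_lhs_C_LP a beta pC) addrAC subrr add0r mulrDr.
  apply: lerD; apply: fsum_weight_le => // t; last rewrite betaE; exact: c_le.
case: p_disj => /=; rewrite -/g ?(ceil_frac gNint) ?floor_frac => p_side.
- apply: (above _ (psi_GMI_ge_floor g)).
  by rewrite mulNr -mulrN mulrC ler_pdivlMr // mul1r; lra.
- apply: (above _ (psi_GMI_ge_ceil g)).
  by rewrite mulrC ler_pdivlMr ?subr_gt0 // mul1r; lra.
Qed.

(** Points with a single nonzero entry in [(s, y)] already force each
    coefficient of a split cut to be at least that of the [a]-cut, for the
    same vector [a]: along such a ray the cut and the split functional are
    linear in that entry, so [psi_GMI_le_slope] applies. *)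
Lemma split_cut_ge_alpha_cut f R Q a (beta : Q -> int)
    (psi : R -> K) (pi : Q -> K) :
  Zf f a -> is_cut psi pi -> valid (C_LP f R Q `&` split_disj f a beta) psi pi ->
  (forall r, psi_alpha f a (val r) <= psi r) /\
  (forall q, pi_alpha f a (val q) <= pi q).
Proof.
move=> [_ gNint] [psi0 pi0] cut; split=> [r|q].
- apply: (psi_GMI_le_slope gNint) => // t t0 side.
  pose s r' : K := if r' == r then t else 0.
  have pC : C_LP f R Q (point_of f s (fun=> 0)).
    by apply: C_LP_point_of; [exact: finsupp_nneg_single|exact: finsupp_nneg0].
  have : satisfies psi pi (point_of f s (fun=> 0)).
    apply: cut; split=> //; rewrite /split_disj /setU /mkset /= (split_lhs_C_LP a beta pC) /=.
    rewrite (fsum_single (t0 := r)) => [|r' /negPf r'r]; last first.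
      by rewrite /s r'r mulr0.
    by rewrite fsbig1 ?addr0 /s ?eqxx // => q _; rewrite mulr0.
  rewrite /satisfies /= (fsum_single (t0 := r)) => [|r' /negPf r'r]; last first.
    by rewrite /s r'r mulr0.
  by rewrite fsbig1 ?addr0 /s ?eqxx // => q _; rewrite mulr0.
- apply: le_trans (pi_GMI_le_shift gNint _ (beta q)) _.
  apply: (psi_GMI_le_slope gNint) => // t t0 side.
  pose y q' : K := if q' == q then t else 0.
  have pC : C_LP f R Q (point_of f (fun=> 0) y).
    by apply: C_LP_point_of; [exact: finsupp_nneg0|exact: finsupp_nneg_single].
  have : satisfies psi pi (point_of f (fun=> 0) y).
    apply: cut; split=> //; rewrite /split_disj /setU /mkset /= (split_lhs_C_LP a beta pC) /=.
    rewrite (fsum_single (t0 := q)) => [|q' /negPf q'q]; last first.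
      by rewrite /y q'q mulr0.
    by rewrite fsbig1 ?add0r /y ?eqxx // => r _; rewrite mulr0.
  rewrite /satisfies /= (fsum_single (t0 := q)) => [|q' /negPf q'q]; last first.
    by rewrite /y q'q mulr0.
  by rewrite fsbig1 ?add0r /y ?eqxx // => r _; rewrite mulr0.
Qed.

Lemma dominates_coef_le f R Q (psi psi' : R -> K) (pi pi' : Q -> K) :
  (forall r, psi r <= psi' r) -> (forall q, pi q <= pi' q) ->
  dominates (C_LP f R Q) psi pi psi' pi'.
Proof.
move=> psi_le pi_le p [sfs yfs _] /le_trans; apply.
by apply: lerD; rewrite -[leLHS]mul1r; apply: fsum_weight_le => // t;
  rewrite mul1r.
Qed.

End Cuts.

Theorem theorem1 (K : realType) (n : nat) (f : 'rV[K]_n) (R Q : set 'rV[K]_n) :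
  (1 <= n)%N ->
  (forall i, 0 <= f ord0 i <= 1) ->
  f \isn't a mxOver Num.int ->
  (forall alpha, Zf f alpha ->
     is_split_cut f (fun r : R => psi_alpha f alpha (val r))
                    (fun q : Q => pi_alpha f alpha (val q)))
  /\
  (forall (psi : R -> K) (pi : Q -> K), is_split_cut f psi pi ->
     exists2 alpha, Zf f alpha &
       dominates (C_LP f R Q)
         (fun r : R => psi_alpha f alpha (val r))
         (fun q : Q => pi_alpha f alpha (val q))
         psi pi).
Proof.
move=> _ _ _; split=> [alpha|psi pi [psi_pi_cut [a [beta [Za cut]]]]].
  exact: alpha_cut_is_split_cut.
have [psi_ge pi_ge] := split_cut_ge_alpha_cut Za psi_pi_cut cut.
by exists a => //; apply: dominates_coef_le.
Qed.
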